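(* Let $p\ge 2$ be real and $p'=\frac{p}{p-1}$. Suppose $c>0$ is such that for every measure space $(X,\mu)$ and every finite sequence $(f_j)_j$ of functions in $L^p(X,\mu)$, $$\Big\|\sum_j f_j\Big\|_p\le\Big(\sup_j\sum_k\alpha_{jk}^{\,c}\Big)^{1/p'}\Big(\sum_j\|f_j\|_p^p\Big)^{1/p}.$$ Then $c\le p'$.
   Context: For $f_j,f_k\in L^p(X,\mu)$ with $p\ge2$, define $\alpha_{jk}:=\sqrt{\dfrac{\|f_jf_k\|_{p/2}}{\|f_j\|_p\|f_k\|_p}}\in[0,1]$ if $\|f_j\|_p\|f_k\|_p\ne0$, and $\alpha_{jk}:=0$ if $\|f_j\|_p\|f_k\|_p=0$. Here $\|f\|_q=(\int_X|f|^q\,d\mu)^{1/q}$. The supremum over $j$ and the sum over $k$ run over the index set of the finite sequence (the term $k=j$ is included). *)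

(* Defs.v *)
From HB Require Import structures.
From mathcomp Require Import all_boot all_order all_algebra.
From mathcomp Require Import all_classical all_reals all_analysis.
Set Implicit Arguments.
Unset Strict Implicit.
Unset Printing Implicit Defensive.
Import Order.TTheory GRing.Theory Num.Theory.
Import numFieldNormedType.Exports.
Local Open Scope classical_set_scope.
Local Open Scope ring_scope.

(* [fine] sends +oo to 0, so this is the L^q norm only when that norm is
   finite.  For f, g in L^p this covers f and f + g (q = p), and f * g
   (q = p / 2, by Cauchy-Schwarz). *)
Definition Lnormr d (T : measurableType d) (R : realType)
    (mu : {measure set T -> \bar R}) (q : R) (f : T -> R) : R :=
  fine (Lnorm mu q%:E (EFin \o f)).

Definition alpha d (T : measurableType d) (R : realType)
    (mu : {measure set T -> \bar R}) (p : R) (f g : T -> R) : R :=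
  if Lnormr mu p f * Lnormr mu p g != 0 then
    Num.sqrt (Lnormr mu (p / 2) (f \* g) / (Lnormr mu p f * Lnormr mu p g))
  else 0.

Definition conj_exponent (R : realType) (p : R) : R := p / (p - 1).

(* Main.v *)
Require Import Defs.
From HB Require Import structures.
From mathcomp Require Import all_boot all_order all_algebra.
From mathcomp Require Import all_classical all_reals all_analysis.
From mathcomp Require Import ring lra.
Import Order.TTheory GRing.Theory Num.Theory.
Import numFieldNormedType.Exports.
Local Open Scope classical_set_scope.
Local Open Scope ring_scope.

(** The bound fails for c > p' on a star of functions: N functions f_0, ...,
    f_(N-1) that share one atom, where each takes the value a, and of which
    f_j also takes the value 1 on an atom of its own.  Then
    ||f_j||_p^p = a^p + 1 and ||sum_j f_j||_p^p = (N a)^p + N, while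
    alpha_jj = 1 and alpha_jk <= a for j <> k, since ||f_j f_k||_(p/2) = a^2
    and the norms in the denominator are at least 1.  The assumed inequality
    therefore gives
      ((N a)^p + N)^(1/p) <= (1 + N a^c)^(1/p') * (N (a^p + 1))^(1/p).

    The values on the common atom add up coherently.  The choice
    a = N^(-1/p') makes (N a)^p = N, so that the common atom contributes to
    the left side as much as all private atoms together, although a^p =
    N^(-(p-1)) is negligible in each single norm.  After division by N^(1/p),
      2^(1/p) <= (1 + N^(1 - c/p'))^(1/p') * (1 + N^(-(p-1)))^(1/p).
    If c > p', both exponents of N on the right are negative; for N large both
    perturbations of 1 are at most e, and since 1/p' + 1/p = 1 the right side
    is then at most 1 + e.  This is a contradiction when 1 + e < 2^(1/p). *)

(** * Finitely many unit atoms *)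

(** Living on nat, where every set is measurable, the atoms 0, ..., N make
    every function measurable; 0 is the common atom and k.+1 the private atom
    of the k-th function. *)
Definition atoms (R : realType) (N : nat) : {measure set nat -> \bar R} :=
  msum (fun k : nat => \d_k : {measure set nat -> \bar R}) N.+1.

Lemma ge0_integral_atoms {R : realType} (N : nat) (g : nat -> R) :
  (forall x, 0 <= g x) ->
  (\int[atoms R N]_x (g x)%:E = (\sum_(k < N.+1) g k)%:E)%E.
Proof.
move=> g0; rewrite ge0_integral_measure_sum//; last by move=> x _; rewrite lee_fin.
rewrite -sumEFin; apply: eq_bigr => i _.
by rewrite integral_dirac// diracT mul1e.
Qed.

Lemma Lnorm_atoms {R : realType} (N : nat) (q : R) (f : nat -> R) :
  Lnorm (atoms R N) q%:E (EFin \o f) =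
    ((\sum_(k < N.+1) `|f k| `^ q) `^ q^-1)%:E.
Proof.
rewrite unlock -[RHS]poweR_EFin; congr (_ `^ _)%E.
by rewrite -(ge0_integral_atoms N (fun x => `|f x| `^ q))// => x; exact: powR_ge0.
Qed.

Lemma Lfun_atoms {R : realType} (N : nat) (q : R) (f : nat -> R) :
  f \in Lfun (atoms R N) q%:E.
Proof.
apply/andP; split; rewrite inE; first by [].
by rewrite /= /finite_norm Lnorm_atoms ltry.
Qed.

(** * The star of functions *)

Definition star {R : realType} (a : R) (j : nat) (x : nat) : R :=
  if x is k.+1 then (k == j)%:R else a.

Section star.
Context {R : realType} (a : R) (N : nat) (a0 : 0 <= a).

Lemma sum_delta (j : 'I_N) : \sum_(k < N) ((k == j :> nat)%:R : R) = 1.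
Proof.
rewrite (bigD1 j)//= eqxx big1 ?addr0// => k kj.
by move: kj; rewrite -val_eqE/= => /negbTE ->.
Qed.

Lemma Lnormr_star (q : R) (j : 'I_N) : q != 0 ->
  Lnormr (atoms R N) q (star a j) = (a `^ q + 1) `^ q^-1.
Proof.
move=> q0; rewrite /Lnormr Lnorm_atoms /= big_ord_recl /= ger0_norm//.
congr ((_ + _) `^ _); rewrite -[RHS](sum_delta j); apply: eq_bigr => k _.
by rewrite /bump/=; case: eqP => _; rewrite ?normr1 ?powR1// normr0 powR0.
Qed.

(** The two functions overlap only at the common atom, so the norm of their
    product does not depend on the exponent. *)
Lemma Lnormr_star_mul (q : R) (j k : 'I_N) : q != 0 -> j != k ->
  Lnormr (atoms R N) q (star a j \* star a k) = a ^+ 2.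
Proof.
move=> q0 jk; rewrite /Lnormr Lnorm_atoms /= big_ord_recl /= big1 => [|i _].
  by rewrite addr0 -powRrM divff// ger0_norm ?mulr_ge0// powRr1 ?expr2// mulr_ge0.
rewrite /bump/=; have [->|_] := eqVneq (i : nat) j; last by rewrite mul0r normr0 powR0.
by move: jk; rewrite -val_eqE/= => /negbTE ->; rewrite mulr0 normr0 powR0.
Qed.

(** Equality case of the Cauchy-Schwarz bound on alpha. *)
Lemma Lnormr_star_sqr (q : R) (j : 'I_N) : q != 0 ->
  Lnormr (atoms R N) (q / 2) (star a j \* star a j) =
    Lnormr (atoms R N) q (star a j) ^+ 2.
Proof.
move=> q0; have q20 : q / 2 != 0 by rewrite mulf_neq0// invr_neq0.
rewrite Lnormr_star// -powR_mulrn ?powR_ge0// -powRrM.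
rewrite /Lnormr Lnorm_atoms /= big_ord_recl /= invfM invrK.
congr ((_ + _) `^ _).
  rewrite ger0_norm ?mulr_ge0// -expr2 -powR_mulrn// -powRrM.
  by congr (_ `^ _); field.
rewrite -[RHS](sum_delta j); apply: eq_bigr => k _.
by rewrite /bump/=; case: eqP => _; rewrite ?mulr1 ?mulr0 ?normr1 ?powR1// normr0 powR0.
Qed.

Lemma Lnormr_star_ge1 (q : R) (j : 'I_N) : 0 < q ->
  1 <= Lnormr (atoms R N) q (star a j).
Proof.
move=> q0; rewrite Lnormr_star ?gt_eqF//.
rewrite -[leLHS](powRr0 (a `^ q + 1)).
by apply: ler_powR; rewrite ?lerDr ?powR_ge0// invr_ge0 ltW.
Qed.

Lemma alpha_star_diag (p : R) (j : 'I_N) : 0 < p ->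
  alpha (atoms R N) p (star a j) (star a j) = 1.
Proof.
move=> p0; have n1 := Lnormr_star_ge1 p j p0.
have n0 : Lnormr (atoms R N) p (star a j) != 0 by rewrite gt_eqF// (lt_le_trans ltr01).
by rewrite /alpha mulf_neq0// Lnormr_star_sqr ?gt_eqF// -expr2 divff ?expf_neq0// sqrtr1.
Qed.

Lemma alpha_star_le (p : R) (j k : 'I_N) : 0 < p -> j != k ->
  alpha (atoms R N) p (star a j) (star a k) <= a.
Proof.
move=> p0 jk; rewrite /alpha; case: ifP => // _.
have n1 : 1 <= Lnormr (atoms R N) p (star a j) * Lnormr (atoms R N) p (star a k).
  by rewrite -[leLHS]mulr1 ler_pM// Lnormr_star_ge1.
rewrite Lnormr_star_mul//; last by rewrite mulf_neq0// ?gt_eqF// invr_gt0.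
rewrite -[leRHS](ger0_norm a0) -sqrtr_sqr ler_wsqrtr//.
by rewrite ler_pdivrMr ?(lt_le_trans ltr01)// ler_peMr// sqr_ge0.
Qed.

Lemma alpha_ge0 d (T : measurableType d) (mu : {measure set T -> \bar R}) p f g :
  0 <= alpha mu p f g.
Proof. by rewrite /alpha; case: ifP => // _; rewrite sqrtr_ge0. Qed.

Lemma sum_alpha_star_le (p c : R) (j : 'I_N) : 0 < p -> 0 <= c ->
  \sum_(k < N) alpha (atoms R N) p (star a j) (star a k) `^ c
  <= 1 + N%:R * a `^ c.
Proof.
move=> p0 c0; rewrite (bigD1 j)//= alpha_star_diag// powR1 lerD2l.
have -> : N%:R * a `^ c = \sum_(k < N) a `^ c.
  by rewrite sumr_const card_ord mulr_natl.
rewrite [leRHS](bigD1 j)//= -[leLHS]add0r lerD ?powR_ge0//.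
apply: ler_sum => k kj; apply: ge0_ler_powR; rewrite ?nnegrE ?alpha_ge0//.
by rewrite alpha_star_le// eq_sym.
Qed.

Lemma sup_alpha_star_le (p c : R) : (0 < N)%N -> 0 < p -> 0 <= c ->
  0 <= sup (range (fun j : 'I_N =>
    \sum_(k < N) alpha (atoms R N) p (star a j) (star a k) `^ c))
  <= 1 + N%:R * a `^ c.
Proof.
move=> N0 p0 c0; set A := range _.
have A1 : A (\sum_(k < N)
    alpha (atoms R N) p (star a (Ordinal N0)) (star a k) `^ c).
  by exists (Ordinal N0).
have ubA : ubound A (1 + N%:R * a `^ c).
  by move=> _ [j _ <-]; exact: sum_alpha_star_le.
apply/andP; split; last by apply: ge_sup ubA; eexists; exact: A1.
apply: le_trans (ub_le_sup (ex_intro _ _ ubA) A1).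
by apply: sumr_ge0 => k _; exact: powR_ge0.
Qed.

Lemma Lnormr_sum_star (p : R) : p != 0 ->
  Lnormr (atoms R N) p (fun x => \sum_(j < N) star a j x) =
    ((N%:R * a) `^ p + N%:R) `^ p^-1.
Proof.
move=> p0; rewrite /Lnormr Lnorm_atoms /= big_ord_recl /=.
congr ((_ + _) `^ _).
  by rewrite sumr_const card_ord mulr_natl ger0_norm ?mulrn_wge0.
rewrite (eq_bigr (fun=> 1)) ?sumr_const ?card_ord// => k _.
under eq_bigr do rewrite /bump/= eq_sym.
by rewrite sum_delta normr1 powR1.
Qed.

End star.

(** * The limit of a large star *)

(** The bound is required for all N beyond M, and not just for one, so that a
    single N can serve two different exponents. *)
Lemma powR_natN_le {R : realType} (e d : R) : 0 < e -> 0 < d ->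
  exists M : nat, forall N : nat, (M < N)%N -> N%:R `^ (- d) <= e.
Proof.
move=> e0 d0; exists (Num.truncn (e `^ (- d^-1))) => N MN.
have N0 : (0 < N%:R :> R) by rewrite ltr0n (leq_ltn_trans _ MN).
have h : e `^ (- d^-1) <= N%:R.
  apply: ltW; apply: lt_le_trans (_ : (Num.truncn (e `^ (- d^-1))).+1%:R <= _).
    exact: truncnS_gt.
  by rewrite ler_nat.
have : (e `^ (- d^-1)) `^ d <= N%:R `^ d.
  by apply: ge0_ler_powR; rewrite ?nnegrE ?powR_ge0// ltW.
rewrite -powRrM mulNr mulVf ?gt_eqF// powR_inv1 ?(ltW e0)// powRN => h2.
by rewrite -[leRHS]invrK lef_pV2// posrE ?powR_gt0 ?invr_gt0.
Qed.

Theorem proposition2p1 (R : realType) (p c : R) (hp : 2 <= p) (hc : 0 < c)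
    (hineq : forall (d : measure_display) (T : measurableType d)
        (mu : {measure set T -> \bar R}) (n : nat) (f : 'I_n -> T -> R),
      (forall j : 'I_n, f j \in Lfun mu p%:E) ->
      Lnormr mu p (fun x : T => \sum_(j < n) f j x) <=
        sup (range (fun j : 'I_n =>
               \sum_(k < n) alpha mu p (f j) (f k) `^ c))
          `^ (1 / conj_exponent p)
        * (\sum_(j < n) Lnormr mu p (f j) `^ p) `^ (1 / p)) :
  c <= conj_exponent p.
Proof.
have p0 : 0 < p by apply: lt_le_trans hp.
have pn0 : p != 0 by rewrite gt_eqF.
have p1 : 0 < p - 1 by lra.
rewrite leNgt; apply/negP => cp.
set s := 1 / conj_exponent p in hineq.
have sE : s = 1 - p^-1.
  by rewrite /s /conj_exponent; field; rewrite pn0 gt_eqF.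
have s0 : 0 < s by rewrite /s div1r invr_gt0 /conj_exponent divr_gt0.
have d0 : 0 < s * c - 1.
  by rewrite subr_gt0 /s div1r mulrC ltr_pdivlMr ?mul1r// divr_gt0.
have V0 : 0 < p^-1 by rewrite invr_gt0.
(* Any e with 1 + e < 2 `^ p^-1 contradicts the final bound; this one is half
   of the gap. *)
pose e : R := (2 `^ p^-1 - 1) / 2.
have r1 : 1 < 2 `^ p^-1 :> R.
  have : 1 `^ p^-1 < 2 `^ p^-1 :> R.
    by apply: gt0_ltr_powR; rewrite ?nnegrE ?ler0n ?ltr1n.
  by rewrite powR1.
have e0 : 0 < e by rewrite /e; lra.
have [M1 hM1] := powR_natN_le e _ e0 d0.
have [M2 hM2] := powR_natN_le e _ e0 p1.
pose N := (M1 + M2).+1.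
have := hM1 N; rewrite ltnS leq_addr => /(_ isT) {}hM1.
have := hM2 N; rewrite ltnS leq_addl => /(_ isT) {}hM2.
have N0 : 0 < N%:R :> R by rewrite ltr0n.
(* The smallest size of a for which the common atom carries as much of the
   norm of the sum as the private atoms do. *)
pose a : R := N%:R `^ (- s).
have a0 : 0 <= a by exact: powR_ge0.
have NaE z : N%:R * a `^ z = N%:R `^ (1 - s * z).
  rewrite /a -powRrM powRD; last by rewrite (gt_eqF N0) implybT.
  by rewrite powRr1 ?(ltW N0)// mulNr.
have := hineq _ _ (atoms R N) N (fun j => star a j) (fun j => Lfun_atoms N p _).
rewrite Lnormr_sum_star//.
have -> : (N%:R * a) `^ p = N%:R.
  rewrite -[a]powRr1// NaE mulr1 sE opprB addrC subrK -powRrM mulVf//.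
  by rewrite powRr1// ltW.
rewrite (eq_bigr (fun=> a `^ p + 1)); last first.
  move=> j _; rewrite Lnormr_star// -powRrM mulVf// powRr1//.
  by rewrite addr_ge0// powR_ge0.
rewrite sumr_const card_ord -[(_ + 1) *+ N]mulr_natl div1r.
have -> : N%:R + N%:R = N%:R * 2 :> R by ring.
rewrite !powRM ?addr_ge0 ?powR_ge0 ?(ltW N0)//.
rewrite mulrCA ler_pM2l ?powR_gt0// => main.
suff : 2 `^ p^-1 <= 1 + e by rewrite /e; lra.
apply: le_trans main _.
(* Splitting 1 + e along s + p^-1 = 1 bounds the two factors separately. *)
have -> : 1 + e = (1 + e) `^ s * (1 + e) `^ p^-1.
  rewrite -powRD; last by rewrite (gt_eqF (addr_gt0 ltr01 e0)) implybT.
  by rewrite sE subrK powRr1// addr_ge0// ltW.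
have e1 : 0 <= 1 + e by rewrite addr_ge0// ltW.
apply: ler_pM; rewrite ?powR_ge0//.
- have /andP[sup0 supa] := sup_alpha_star_le a N a0 p c (ltn0Sn _) p0 (ltW hc).
  apply: ge0_ler_powR; rewrite ?nnegrE ?(ltW s0)//.
  by apply: le_trans supa _; rewrite NaE lerD2l -opprB.
- apply: ge0_ler_powR; rewrite ?nnegrE ?(ltW V0) ?addr_ge0 ?powR_ge0 ?(ltW e0)//.
  rewrite addrC lerD2l /a -powRrM mulNr.
  by have -> : s * p = p - 1 by rewrite sE; field.
Qed.
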